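(* Let $N\ge 1$ be an integer, let $a,b>0$ be real numbers, and consider the $N$-round biased-coin game in which Reality's move space is $\{a,-b\}$. Let $S_N=x_1+\dots+x_N$ be the sum of Reality's moves, and let $\eta$ be any real-valued function on the set $\{ma-(N-m)b : m=0,\dots,N\}$ of possible values of $S_N$. Then the upper and lower expected values of $\eta(S_N)$ coincide and are given by $$\overline{\mathbb E}(\eta(S_N))=\underline{\mathbb E}(\eta(S_N))=\sum_{m=0}^N\binom{N}{m}p^m(1-p)^{N-m}\,\eta\bigl(ma-(N-m)b\bigr),\qquad p=\frac{b}{a+b}.$$
   Context: Biased-coin game: the initial capital $\mathcal K_0\in\mathbb R$ and $a,b>0$ are given. In each round $n=1,\dots,N$, Skeptic announces $M_n\in\mathbb R$, then Reality announces $x_n\in\{a,-b\}$, and Skeptic's capital is updated by $\mathcal K_n=\mathcal K_{n-1}+M_nx_n$. A path is a sequence $\xi=x_1\dots x_N$ of Reality's moves. A strategy $\mathcal P$ of Skeptic specifies each $M_n$ as a function of Reality's previous moves $x_1,\dots,x_{n-1}$. $\mathcal K^{\mathcal P}_n(\xi)$ denotes Skeptic's capital after round $n$ along $\xi$ when he uses $\mathcal P$ with initial capital $0$. A random variable is a real-valued function $x(\xi)$ of the path. Its upper and lower expected values are $$\overline{\mathbb E}x=\inf\{\alpha\in\mathbb R \mid \exists\mathcal P\ \forall\xi:\ \mathcal K^{\mathcal P}_N(\xi)\ge x(\xi)-\alpha\},$$ $$\underline{\mathbb E}x=\sup\{\alpha\in\mathbb R \mid \exists\mathcal P\ \forall\xi:\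 \mathcal K^{\mathcal P}_N(\xi)\ge \alpha-x(\xi)\}.$$ *)

(* Defs.v *)
From mathcomp Require Import all_boot all_order all_algebra.
From mathcomp Require Import classical_sets reals constructive_ereal ereal.
Set Implicit Arguments.
Unset Strict Implicit.
Unset Printing Implicit Defensive.
Import Order.TTheory GRing.Theory Num.Theory.
Local Open Scope classical_set_scope.
Local Open Scope ring_scope.

Section BiasedCoinGame.
Variables (R : realType) (a b : R).

(* The move space {a, -b} as a subtype of R; [ssval] is the real value. *)
Definition move : predArgType := seq_sub [:: a; - b].

Definition coin_path (N : nat) : predArgType := N.-tuple move.

(* [P s] is the announced M_n with n = (size s).+1, where s = x_1 ... x_{n-1}
   is the history; the round number is recovered from the history. *)
Definition strategy := seq move -> R.

(* K_n along xi, from initial capital K0.  Moves are 0-indexed, so that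
   x_{n+1} is the n-th item and [take n xi] is x_1 ... x_n; the default 0 of
   [nth] is only reached for n >= N. *)
Fixpoint capital (N : nat) (K0 : R) (P : strategy) (xi : coin_path N) (n : nat)
    : R :=
  if n is n'.+1 then
    capital K0 P xi n' + P (take n' xi) * nth 0 [seq ssval x | x <- xi] n'
  else K0.

(* The infimum and supremum are taken in the extended reals: inf and sup on R
   return a default value on sets where they do not exist. *)
Definition upper_expectation (N : nat) (x : coin_path N -> R) : \bar R :=
  ereal_inf [set alpha%:E | alpha in [set alpha : R |
    exists P : strategy, forall xi : coin_path N,
      capital 0 P xi N >= x xi - alpha]].

Definition lower_expectation (N : nat) (x : coin_path N -> R) : \bar R :=
  ereal_sup [set alpha%:E | alpha in [set alpha : R |
    exists P : strategy, forall xi : coin_path N,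
      capital 0 P xi N >= alpha - x xi]].

Definition path_sum (N : nat) (xi : coin_path N) : R :=
  \sum_(i < N) ssval (tnth xi i).

End BiasedCoinGame.

(* Main.v *)
Require Import Defs.
From mathcomp Require Import all_boot all_order all_algebra.
From mathcomp Require Import classical_sets reals constructive_ereal ereal.
From mathcomp Require Import ring lra.
Set Implicit Arguments.
Unset Strict Implicit.
Unset Printing Implicit Defensive.
Import Order.TTheory GRing.Theory Num.Theory.
Local Open Scope ring_scope.

(* The binomial average of [eta] over the remaining rounds satisfies a one-step
   backward recursion, and since Reality has only two moves Skeptic can follow
   it exactly: some strategy Q has capital eta(S_N) - v at time N on every path,
   so v is both an upper and a lower price.  No better price exists: against
   any strategy Reality can always pick the move that does not enrich Skeptic,
   and applying this to P - Q (resp. P + Q) bounds every price from P by v. *)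

(** Pascal's rule on each coefficient. [G] takes both move counts as separate arguments, so each
    half raises just one of them. *)
Lemma sum_binS (R : pzRingType) (n : nat) (G : nat -> nat -> R) :
  \sum_(i < n.+2) 'C(n.+1, i)%:R * G i (n.+1 - i)%N =
  \sum_(i < n.+1) 'C(n, i)%:R * G i.+1 (n - i)%N +
  \sum_(i < n.+1) 'C(n, i)%:R * G i (n.+1 - i)%N.
Proof.
rewrite big_ord_recl.
under eq_bigr => i _ do rewrite lift0 binS natrD mulrDl subSS.
rewrite big_split /= addrA addrC; congr (_ + _).
(* The top term vanishes since ['C(n, n.+1)] is 0; the rest is the second sum without its term at
   0. *)
rewrite [in LHS]big_ord_recr /= (bin_small (ltnSn n)) mul0r addr0.
by rewrite [RHS]big_ord_recl !bin0.
Qed.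

(** [k] counts the rounds left and [S] is the sum so far; [p] is the weight of [a] that gives a move
    mean zero. *)
Definition binomial_price (R : realType) (a b : R) (eta : R -> R) (k : nat)
    (S : R) : R :=
  let p := b / (a + b) in
  \sum_(m < k.+1) 'C(k, m)%:R *
    (p ^+ m * (1 - p) ^+ (k - m) * eta (S + m%:R * a - (k - m)%:R * b)).

Section Prices.
Variables (R : realType) (a b : R).
Hypotheses (ha : 0 < a) (hb : 0 < b).
Variable eta : R -> R.
Let price := binomial_price a b eta.

Lemma binomial_price0 (S : R) : price 0 S = eta S.
Proof.
by rewrite /price /binomial_price big_ord1 bin0 !expr0 !mul1r !mul0r addr0 subr0.
Qed.

Lemma binomial_priceS (k : nat) (S : R) :
  price k.+1 S = b / (a + b) * price k (S + a)
                 + (1 - b / (a + b)) * price k (S - b).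
Proof.
rewrite /price /binomial_price; set p := b / (a + b).
rewrite (sum_binS k (fun i j =>
  p ^+ i * (1 - p) ^+ j * eta (S + i%:R * a - j%:R * b))).
rewrite !mulr_sumr; congr (_ + _); apply: eq_bigr => i _.
  have -> : S + i.+1%:R * a = S + a + i%:R * a by rewrite -natr1; ring.
  by rewrite exprS; ring.
rewrite subSn; last by rewrite -ltnS.
have -> : S + i%:R * a - (k - i).+1%:R * b = S - b + i%:R * a - (k - i)%:R * b.
  by rewrite -natr1; ring.
by rewrite exprS; ring.
Qed.

Lemma capitalD (N : nat) (P Q : strategy a b) (xi : coin_path a b N) n :
  capital 0 (fun s => P s + Q s) xi n = capital 0 P xi n + capital 0 Q xi n.
Proof. by elim: n => [|n /= ->]; [rewrite addr0 | ring]. Qed.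

Lemma capitalN (N : nat) (P : strategy a b) (xi : coin_path a b N) n :
  capital 0 (fun s => - P s) xi n = - capital 0 P xi n.
Proof. by elim: n => [|n /= ->]; [rewrite oppr0 | ring]. Qed.

Lemma move_unfavourable (M : R) : exists x : move a b, M * ssval x <= 0.
Proof.
have ain : a \in [:: a; - b] by rewrite inE eqxx.
have bin : - b \in [:: a; - b] by rewrite !inE eqxx orbT.
have [M0|M0] := leP M 0.
  by exists (SeqSub ain); rewrite mulr_le0_ge0 // ltW.
by exists (SeqSub bin); rewrite /= mulrN oppr_le0 mulr_ge0 ?ltW.
Qed.

Lemma path_capital_le0 (N : nat) (P : strategy a b) :
  exists xi : coin_path a b N, capital 0 P xi N <= 0.
Proof.
(* Bounding each increment lets the path grow by appending: [P] reads only prefixes, so earlier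
   increments do not change. *)
suff [s sN sP] : exists2 s : seq (move a b), size s = N &
    forall n, (n < N)%N ->
      P (take n s) * nth 0 [seq ssval x | x <- s] n <= 0.
  have sNb : size s == N by rewrite sN.
  exists (Tuple sNb).
  suff capS n : (n <= N)%N -> capital 0 P (Tuple sNb) n <= 0 by exact: capS.
  elim: n => // n IHn ltnN /=.
  by rewrite -[leRHS](addr0 0) lerD ?sP ?IHn // ltnW.
elim: N => [|N [s sN sP]]; first by exists [::].
have [x xP] := move_unfavourable (P s).
exists (rcons s x) => [|n]; first by rewrite size_rcons sN.
rewrite map_rcons nth_rcons size_map sN ltnS leq_eqVlt => /predU1P[->|ltnN].
  by rewrite ltnn eqxx -sN -cats1 take_size_cat.
by rewrite ltnN -cats1 takel_cat ?sP // sN ltnW.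
Qed.

Definition history_sum (s : seq (move a b)) : R :=
  \sum_(x <- [seq ssval y | y <- s]) x.

(** The slope of the next price between the two moves, as in the binomial option model; [.-1]
    discounts the round about to be played. *)
Definition delta_hedge (N : nat) : strategy a b := fun s =>
  (price (N - size s).-1 (history_sum s + a)
   - price (N - size s).-1 (history_sum s - b)) / (a + b).

Lemma capital_delta_hedge (N : nat) (xi : coin_path a b N) n : (n <= N)%N ->
  capital 0 (delta_hedge N) xi n
  = price (N - n) (history_sum (take n xi)) - price N 0.
Proof.
elim: n => [|n IHn] ltnN /=.
  by rewrite subn0 take0 /history_sum big_nil subrr.
rewrite IHn ?(ltnW ltnN) // {}/delta_hedge.
rewrite size_takel ?size_tuple ?(ltnW ltnN) //.
set w := [seq ssval x | x <- xi].
have szw : (n < size w)%N by rewrite size_map size_tuple.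
have -> : history_sum (take n.+1 xi) = history_sum (take n xi) + nth 0 w n.
  by rewrite /history_sum !map_take (take_nth 0 szw) -cats1 big_cat big_seq1.
have : nth 0 w n \in [:: a; - b].
  have /mapP[x _ ->] : nth 0 w n \in w by rewrite mem_nth.
  exact: ssvalP.
(* Since a round remains, the price recursion applies; for either move, stake times move is then the
   change in price. *)
rewrite subnS; have : (0 < N - n)%N by rewrite subn_gt0.
case: (N - n)%N => // k _; rewrite binomial_priceS /=.
have ab0 : a + b != 0 by rewrite gt_eqF // addr_gt0.
by rewrite !inE => /orP[] /eqP ->; field.
Qed.

Lemma replicable_expectation (N : nat) (x : coin_path a b N -> R) (v : R)
    (Q : strategy a b) :
  (forall xi, capital 0 Q xi N = x xi - v) ->
  upper_expectation x = v%:E /\ lower_expectation x = v%:E.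
Proof.
move=> QE; split; apply/eqP; rewrite eq_le; apply/andP; split.
- by apply: ereal_inf_lbound; exists v => //; exists Q => xi; rewrite QE.
- apply: le_ereal_inf_tmp => _ [alpha [P PE] <-]; rewrite lee_fin.
  (* The payoff [x xi] cancels in the difference, whose capital is at least [v - alpha] on every
     path. *)
  have [xi] := path_capital_le0 N (fun s => P s + - Q s).
  by rewrite capitalD capitalN QE; have := PE xi; lra.
- apply: ge_ereal_sup => _ [alpha [P PE] <-]; rewrite lee_fin.
  have [xi] := path_capital_le0 N (fun s => P s + Q s).
  by rewrite capitalD QE; have := PE xi; lra.
(* Reversing every stake of [Q] yields exactly [v - x xi]. *)
- apply: ereal_sup_ubound; exists v => //; exists (fun s => - Q s) => xi.
  by rewrite capitalN QE opprB.
Qed.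

End Prices.

Theorem theorem2p1 (R : realType) (N : nat) (hN : (1 <= N)%N)
    (a b : R) (ha : 0 < a) (hb : 0 < b) (eta : R -> R) :
  let p := b / (a + b) in
  let v := \sum_(0 <= m < N.+1)
    'C(N, m)%:R * p ^+ m * (1 - p) ^+ (N - m)%N
      * eta (m%:R * a - (N - m)%N%:R * b) in
  upper_expectation (fun xi : coin_path a b N => eta (path_sum xi)) = v%:E /\
  lower_expectation (fun xi : coin_path a b N => eta (path_sum xi)) = v%:E.
Proof.
move=> p v; apply: (replicable_expectation ha hb (Q := delta_hedge eta N)) => xi.
(* With no rounds left the price is [eta] at the full sum. *)
rewrite capital_delta_hedge // subnn binomial_price0.
rewrite take_oversize ?size_tuple //; congr (eta _ - _).
  by rewrite /history_sum big_map big_tuple.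
rewrite /v big_mkord /binomial_price.
by apply: eq_bigr => m _; rewrite add0r !mulrA.
Qed.
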